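(* Let $K$ be a commutative field of characteristic $0$ and let $A$ be a noncommutative Jordan algebra over $K$ which contains at least one left linearly invertible element. Then $A$ contains a nonzero idempotent.
   Context: Algebras are vector spaces with a bilinear product, not assumed associative or unital and of arbitrary dimension. $(x,y,z)=(xy)z-x(yz)$. An algebra is noncommutative Jordan if $(x,y,x)=0$ and $(x^2,y,x)=0$ for all $x,y$. A nonzero element $x\in A$ is left linearly invertible if $L_x:A\to A$, $y\mapsto xy$, is bijective. An idempotent is an element $e$ with $e^2=e$. *)

(* Defs.v *)
From mathcomp Require Import all_boot all_algebra.

Set Implicit Arguments.
Unset Strict Implicit.
Unset Printing Implicit Defensive.

Import GRing.Theory.
Local Open Scope ring_scope.

(* A K-algebra (neither associative nor unital, of any dimension) is a
   K-module A together with a product mul : {bilinear A -> A -> A}; MathComp's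
   own algebra structures all impose associativity and a unit. *)
Section NonassociativeAlgebra.

Variables (K : fieldType) (A : lmodType K) (mul : {bilinear A -> A -> A}).

Definition associator (x y z : A) : A := mul (mul x y) z - mul x (mul y z).

Definition noncommutative_Jordan : Prop :=
  (forall x y : A, associator x y x = 0) /\
  (forall x y : A, associator (mul x x) y x = 0).

Definition left_linearly_invertible (x : A) : Prop :=
  x != 0 /\ bijective (fun y : A => mul x y).

Definition idempotent_elt (e : A) : Prop := mul e e = e.

End NonassociativeAlgebra.

(* Main.v *)
(** If [a e = a] then flexibility gives [e a = a], and the linearized Jordan
    identity gives [(a, y, f) = 0] for [f = e^2 - 2 e].  At [y = e] this reads
    [a f = a (e f)], so [e f = f]: that is, [e^3 - 3 e^2 + 2 e = 0].  Hence
    [- f] is idempotent, while [f = 0] makes [e / 2] idempotent. *)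
Require Import Defs.
From mathcomp Require Import all_boot all_algebra.

Import GRing.Theory.
Local Open Scope ring_scope.

Section Associator.

Set Implicit Arguments.
Unset Strict Implicit.

Variables (K : fieldType) (A : lmodType K) (mul : {bilinear A -> A -> A}).

Local Notation assoc := (associator mul).

Lemma associatorDl x x' y z : assoc (x + x') y z = assoc x y z + assoc x' y z.
Proof. by rewrite /associator !linearDl /= opprD addrACA. Qed.

Lemma associatorDr x y z z' : assoc x y (z + z') = assoc x y z + assoc x y z'.
Proof. by rewrite /associator !linearDr /= opprD addrACA. Qed.

Lemma associatorNl x y z : assoc (- x) y z = - assoc x y z.
Proof. by rewrite /associator !linearNl /= opprD. Qed.

Lemma associatorNr x y z : assoc x y (- z) = - assoc x y z.
Proof. by rewrite /associator !linearNr /= opprD. Qed.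

Lemma flexible_lin (flex : forall x y, assoc x y x = 0) x y z :
  assoc x y z = - assoc z y x.
Proof.
apply/eqP; rewrite -addr_eq0; apply/eqP.
by rewrite -[RHS](flex (x + z) y) associatorDl !associatorDr !flex add0r addr0.
Qed.

(** This is the part of the Jordan identity at [x + z] that is odd in [z]. Comparing [x + z] with
    [x - z] isolates it at the cost of a factor 2, so no further scalars are needed. *)
Lemma Jordan_lin (two_neq0 : 2%:R != 0 :> K)
    (jord : forall x y, assoc (mul x x) y x = 0) x y z :
  assoc (mul x x) y z + assoc (mul x z + mul z x) y x = 0.
Proof.
set s := mul x z + mul z x.
(* Adding [mul z z] costs nothing, as [(z^2, y, z) = 0], and makes the squares of [x + z] and
   [x - z] equal to [u + s] and [u - s]. *)
set u := mul x x + mul z z.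
have uz : assoc u y z = assoc (mul x x) y z by rewrite associatorDl jord addr0.
rewrite -uz.
(* Under [z -> - z], [u] is fixed and [s] changes sign, so [p] is odd and [q] is even. *)
set p := assoc u y z + _; pose q := assoc u y x + assoc s y z.
have sqD : mul (x + z) (x + z) = u + s.
  by rewrite linearDl !linearDr /= [mul z x + _]addrC addrACA.
have sqB : mul (x - z) (x - z) = u - s.
  rewrite linearDl !linearDr linearNr /= !linearNl linearNr opprK.
  by rewrite [- mul z x + _]addrC addrACA -opprD.
have qDp : q + p = 0.
  by rewrite -(jord (x + z) y) sqD associatorDl !associatorDr [assoc s y x + _]addrC addrACA.
have qBp : q - p = 0.
  rewrite -(jord (x - z) y) sqB associatorDl !associatorDr associatorNr.
  by rewrite !associatorNl associatorNr opprK [- assoc s y x + _]addrC addrACA -opprD.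
have : 2%:R *: p = 0.
  by rewrite scaler_nat mulr2n -[RHS]qDp (subr0_eq qBp).
by move/eqP; rewrite scaler_eq0 (negPf two_neq0) => /eqP.
Qed.

End Associator.

Theorem mainTheorem17 (K : fieldType) (A : lmodType K)
    (mul : {bilinear A -> A -> A})
    (char0 : [pchar K] =i pred0)
    (jordan : noncommutative_Jordan mul)
    (linv : exists a : A, left_linearly_invertible mul a) :
  exists e : A, e != 0 /\ idempotent_elt mul e.
Proof.
have [flex jord] := jordan.
have [a [a_neq0 bij_a]] := linv.
have inj_a : injective (mul a) := bij_inj bij_a.
have [g _ gK] := bij_a.
have two_neq0 : 2%:R != 0 :> K.
  by have := char0 2%N; rewrite !inE /= => ->.
have [e ae] : exists e, mul a e = a by exists (g a); exact: gK.
have e_neq0 : e != 0.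
  by apply: contraNneq a_neq0 => e0; rewrite -ae e0 linear0r.
have ea : mul e a = a.
  (* Flexibility reads [a a = a (e a)]; cancel [a] on the left. *)
  by apply: inj_a; have /subr0_eq := flex a e; rewrite ae => <-.
have we : mul (mul e e) e = mul e (mul e e) := subr0_eq (flex e e).
pose f := mul e e - (e + e).
(* As [e a + a e = 2 a], the linearized identity gives [(e^2, y, a) + 2 (a, y, e) = 0], and
   flexibility turns [(a, y, e)] into [- (e, y, a)]. *)
have afy y : associator mul f y a = 0.
  have := Jordan_lin two_neq0 jord e y a.
  rewrite ea ae associatorDl (flexible_lin flex a y e) -opprD.
  by rewrite /f associatorDl associatorNl associatorDl.
have ef : mul e f = f.
  have /subr0_eq : associator mul a e f = 0.
    by rewrite (flexible_lin flex) afy oppr0.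
  by rewrite ae => af; apply: inj_a; rewrite -af.
have fe : mul f e = f.
  by rewrite -[RHS]ef /f !(linearDl, linearDr, linearNl, linearNr) we.
(* Since [(f, e, e) = (e^2, e, e) - 2 (e, e, e) = 0], [f e^2 = (f e) e = f]. *)
have fw : mul f (mul e e) = f.
  have /subr0_eq : associator mul f e e = 0.
    by rewrite /f associatorDl associatorNl associatorDl jord flex !(addr0, oppr0).
  by rewrite !fe => <-.
have [f0 | f_neq0] := eqVneq f 0; last first.
  exists (- f); split; first by rewrite oppr_eq0.
  (* Expanding the right factor, [f f = f e^2 - 2 f e = f - 2 f = - f]. *)
  rewrite /idempotent_elt linearNl linearNr /= opprK.
  by rewrite {2}/f linearBr /= linearDr /= fw fe opprD addrA subrr add0r.
exists (2%:R^-1 *: e); split; first by rewrite scaler_eq0 invr_eq0 negb_or two_neq0.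
rewrite /idempotent_elt linearZl_LR linearZr_LR /= (subr0_eq f0).
by rewrite -mulr2n -scaler_nat (scalerA 2%:R^-1 2%:R) mulVf // scale1r.
Qed.
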